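(* Let $X=X[0,\infty)$ be a separable rearrangement invariant function space on $[0,\infty)$, with Boyd indices $p_X$ and $q_X$, and let $1<p,q<\infty$. (1) If $X[0,\infty)$ has the $UDS_p$-property, then $p\le p_X$. (2) If $X[0,\infty)$ has the $UDT_q$-property, then $q\ge q_X$.
   Context: Rearrangement invariant (r.i.) function spaces are real and understood in the sense of Lindenstrauss–Tzafriri, Classical Banach Spaces II: Banach lattices of (classes of) measurable functions on $[0,\infty)$ with Lebesgue measure, with the pointwise a.e. order, whose norm depends only on the decreasing rearrangement of $|f|$ (so it is invariant under measure-preserving automorphisms), with $L_1\cap L_\infty\subset X\subset L_1+L_\infty$. In a separable one the step functions are dense. Estimates: a sequence $\{x_k\}_{k=1}^\infty$ in a Banach space has an upper $p$-estimate (resp. a lower $q$-estimate) with constant $C>0$ if for all $n\in\mathbb N$ and $a_1,\dots,a_n\in\mathbb R$, $\|\sum_{k=1}^n a_kx_k\|\le C(\sum_{k=1}^n|a_k|^p)^{1/p}$ (resp. $C(\sum_{k=1}^n|a_k|^q)^{1/q}\le\|\sum_{k=1}^n a_kx_k\|$). A Banach lattice $X$ has the $UDS_p$-property (resp. $UDT_q$-property) if there is a constant $C>0$ such that every normalized disjoint sequence in $X$ (norm-one, pairwise disjoint vectors) has a subsequence with an upper $p$-estimate (resp. a lower $q$-estimate) with constant $C$. Boyd indices: for $0<s<\infty$ let $D_s:X\to X$ be $(D_sf)(t)=f(t/s)$, $0\le t<\infty$. Then $p_X=\lim_{s\to\infty}\frac{\log s}{\log\|D_s\|}$ and $q_X=\lim_{s\to0^+}\frac{\log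 s}{\log\|D_s\|}$, with the usual convention that the index is $\infty$ if the norms in the denominator equal $1$. *)

(* Defs.v *)
From HB Require Import structures.
From mathcomp Require Import all_boot all_order all_algebra.
From mathcomp Require Import all_classical all_reals all_analysis.

Set Implicit Arguments.
Unset Strict Implicit.
Unset Printing Implicit Defensive.

Import Order.TTheory GRing.Theory Num.Theory.
Import numFieldNormedType.Exports.

Local Open Scope classical_set_scope.
Local Open Scope ring_scope.

Definition halfline {R : realType} : set R := `[0, +oo[.

(* A function on [0, oo) is represented by a map R -> R whose values at
   negative points are irrelevant; [ae_half] is "a.e. on [0, oo)". *)
Definition ae_half {R : realType} (P : R -> Prop) : Prop :=
  {ae @lebesgue_measure R, forall x, halfline x -> P x}.

(* f^*(t) = inf {l >= 0 : |{|f| > l}| <= t}, which may be +oo (e.g. at t = 0). *)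
Definition decreasing_rearrangement {R : realType} (f : R -> R) (t : R)
    : \bar R :=
  ereal_inf [set l%:E | l in [set l : R | 0 <= l /\
    (lebesgue_measure (halfline `&` [set x | (l < `|f x|)%R]) <= t%:E)%E]].

Definition in_L1 {R : realType} (f : R -> R) : Prop :=
  (@lebesgue_measure R).-integrable halfline (EFin \o f).

Definition in_Linfty {R : realType} (f : R -> R) : Prop :=
  measurable_fun halfline f /\ exists M : R, ae_half (fun x => `|f x| <= M).

(* The elements are functions rather than classes: [ri_norm] is only
   significant on [ri_mem], where it is a seminorm vanishing exactly on the
   functions that are null a.e.  Invariance under a.e. equality, and the
   lattice operations, come from the ideal property [ri_ideal]. *)
Record ri_space (R : realType) := RISpace {
  ri_mem :> (R -> R) -> Prop;
  ri_norm : (R -> R) -> R;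
  ri_measurable : forall f, ri_mem f -> measurable_fun halfline f;
  ri_add : forall f g, ri_mem f -> ri_mem g -> ri_mem (f + g);
  ri_scale : forall (a : R) f, ri_mem f -> ri_mem (a *: f);
  ri_norm_triangle : forall f g, ri_mem f -> ri_mem g ->
    ri_norm (f + g) <= ri_norm f + ri_norm g;
  ri_norm_scale : forall (a : R) f, ri_mem f ->
    ri_norm (a *: f) = `|a| * ri_norm f;
  ri_norm_definite : forall f, ri_mem f -> ri_norm f = 0 ->
    ae_half (fun x => f x = 0);
  ri_complete : forall u : nat -> R -> R, (forall n, ri_mem (u n)) ->
    (forall e : R, 0 < e -> exists n0, forall m n, (n0 <= m)%N -> (n0 <= n)%N ->
      ri_norm (u m - u n) < e) ->
    exists2 f, ri_mem f & ri_norm (u n - f) @[n --> \oo] --> (0 : R);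
  ri_ideal : forall f g : R -> R, ri_mem f -> measurable_fun halfline g ->
    ae_half (fun x => `|g x| <= `|f x|) -> ri_mem g /\ ri_norm g <= ri_norm f;
  ri_rearrangement_invariant : forall f g : R -> R,
    ri_mem f -> measurable_fun halfline g ->
    (forall t, 0 <= t ->
      decreasing_rearrangement g t = decreasing_rearrangement f t) ->
    ri_mem g /\ ri_norm g = ri_norm f;
  ri_L1_cap_Linfty : forall f : R -> R, in_L1 f -> in_Linfty f -> ri_mem f;
  ri_L1_add_Linfty : forall f, ri_mem f ->
    exists g h, [/\ in_L1 g, in_Linfty h & ae_half (fun x => f x = g x + h x)]
}.

Definition ri_separable {R : realType} (X : ri_space R) : Prop :=
  exists u : nat -> R -> R, (forall n, X (u n)) /\
    forall f, X f -> forall e : R, 0 < e -> exists n, ri_norm X (f - u n) < e.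

Definition upper_estimate {R : realType} (X : ri_space R) (p C : R)
    (x : nat -> R -> R) : Prop :=
  forall (n : nat) (a : nat -> R),
    ri_norm X (\sum_(k < n) a k *: x k)
      <= C * (\sum_(k < n) `|a k| `^ p) `^ p^-1.

Definition lower_estimate {R : realType} (X : ri_space R) (q C : R)
    (x : nat -> R -> R) : Prop :=
  forall (n : nat) (a : nat -> R),
    C * (\sum_(k < n) `|a k| `^ q) `^ q^-1
      <= ri_norm X (\sum_(k < n) a k *: x k).

Definition normalized_disjoint {R : realType} (X : ri_space R)
    (x : nat -> R -> R) : Prop :=
  [/\ forall n, X (x n), forall n, ri_norm X (x n) = 1 &
      forall m n, m <> n ->
        ae_half (fun t => Num.min `|x m t| `|x n t| = 0)].

Definition UDS {R : realType} (p : R) (X : ri_space R) : Prop :=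
  exists2 C : R, 0 < C & forall x, normalized_disjoint X x ->
    exists2 phi : nat -> nat, {homo phi : m n / (m < n)%N} &
      upper_estimate X p C (x \o phi).

Definition UDT {R : realType} (q : R) (X : ri_space R) : Prop :=
  exists2 C : R, 0 < C & forall x, normalized_disjoint X x ->
    exists2 phi : nat -> nat, {homo phi : m n / (m < n)%N} &
      lower_estimate X q C (x \o phi).

Definition dilation {R : realType} (s : R) (f : R -> R) : R -> R :=
  fun t => f (t / s).

Definition dilation_norm {R : realType} (X : ri_space R) (s : R) : R :=
  sup [set ri_norm X (dilation s f) | f in [set f | X f /\ ri_norm X f <= 1]].

(* If the norm is 1 for one s > 1 then it is 1 for all s > 1, and likewise
   for s < 1, so the convention can be imposed pointwise in s. *)
Definition boyd_ratio {R : realType} (X : ri_space R) (s : R) : \bar R :=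
  if dilation_norm X s == 1 then +oo%E
  else (ln s / ln (dilation_norm X s))%:E.

Definition lower_boyd_index {R : realType} (X : ri_space R) : \bar R :=
  lim (boyd_ratio X s @[s --> +oo]).

Definition upper_boyd_index {R : realType} (X : ri_space R) : \bar R :=
  lim (boyd_ratio X s @[s --> 0^'+]).

(* Main.v *)
Require Import Defs.
From mathcomp Require Import all_boot all_order all_algebra.
From mathcomp Require Import all_classical all_reals all_analysis.
From mathcomp Require Import measurable_realfun lra.
Import Order.TTheory GRing.Theory Num.Theory.
Import numFieldNormedType.Exports.
Local Open Scope ring_scope.
Local Open Scope classical_set_scope.

(* On the half-line a function f has infinitely many disjoint equimeasurable
   copies, and the sum of n of them is equimeasurable with D_n f.  If |f| = 1,
   the UDS_p-property applied to the copies gives |D_n f| <= C n^(1/p); the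
   UDT_q-property gives |D_n f| >= C n^(1/q), that is |D_(1/n)| <= C^-1 n^(-1/q)
   since f = D_n (D_(1/n) f).  The function u |-> ln |D_(e^u)| is subadditive
   and nondecreasing, so Fekete's lemma shows that the limits defining the Boyd
   indices exist and can be compared with these bounds. *)

(** * Lebesgue measure under affine changes of variable *)

Lemma measurable_affine {R : realType} (s c : R) :
  measurable_fun [set: R] (fun x => s * x + c).
Proof. by apply: measurable_funD => //; apply: measurable_funM. Qed.

(** Follows from the uniqueness of Lebesgue measure: [s] times its pushforward under the affine map
    gives every interval []a, b]] its length. *)
Lemma lebesgue_measure_affine {R : realType} (s c : R) (A : set R) :
  0 < s -> measurable A ->
  lebesgue_measure ((fun x => s * x + c) @^-1` A)
    = (s^-1%:E * lebesgue_measure A)%E.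
Proof.
move=> s0 mA.
pose m : {measure set (measurableTypeR R) -> \bar R} :=
  pushforward (@lebesgue_measure R)
    ((fun x => s * x + c) : measurableTypeR R -> measurableTypeR R).
have s0' : 0 <= s by exact: ltW.
pose m' : {measure set (measurableTypeR R) -> \bar R} :=
  mscale (NngNum s0') (m (measurable_affine s c)).
suff -> : lebesgue_measure A = m' A.
  by rewrite /m' /mscale /= muleA -EFinM mulVf ?lt0r_neq0// mul1e.
apply: lebesgue_measure_unique => //= _ [[a b]] _ <-.
rewrite /m' /mscale /m /= /pushforward.
have -> : (fun x => s * x + c) @^-1` `]a, b]
    = `](a - c) / s, (b - c) / s]%classic.
  apply/seteqP; split=> x /=;
  by rewrite !in_itv/= ltr_pdivrMr// ler_pdivlMr// ltrBlDr lerBrDr (mulrC x).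
rewrite !lebesgue_measure_itv/= !lte_fin ltr_pM2r ?invr_gt0// ltrD2r.
case: ifPn => _; last by rewrite mule0.
rewrite -!EFinB -EFinM; congr EFin.
by rewrite -mulrBl mulrCA mulfV ?lt0r_neq0// mulr1; lra.
Qed.

(** * Distribution functions and equimeasurability *)

Lemma halflineE {R : realType} (t : R) : halfline t = (0 <= t) :> Prop.
Proof. by rewrite /halfline/= in_itv/= andbT. Qed.

Definition level {R : realType} (f : R -> R) (l : R) : set R :=
  halfline `&` [set x | l < `|f x|].

Definition distr {R : realType} (f : R -> R) (l : R) : \bar R :=
  lebesgue_measure (level f l).

Lemma measurable_halfline {R : realType} : measurable (@halfline R).
Proof. exact: measurable_itv. Qed.

Lemma measurable_level {R : realType} (f : R -> R) (l : R) :
  measurable_fun halfline f -> measurable (level f l).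
Proof.
move=> mf; rewrite /level.
have mn : measurable_fun halfline (fun x => `|f x|).
  by apply: measurableT_comp.
have -> : [set x | l < `|f x|] = (fun x => `|f x|) @^-1` `]l, +oo[.
  by apply/seteqP; split=> x /=; rewrite in_itv/= andbT.
by apply: mn; [exact: measurable_halfline|exact: measurable_itv].
Qed.

(** The decreasing rearrangement is computed from the values of [distr] at levels [l >= 0] alone.
    Distribution functions are the handier invariant here because they add up over disjoint
    supports. *)
Lemma ri_equimeasurable {R : realType} {X : ri_space R} (f g : R -> R) :
  X f -> measurable_fun halfline g ->
  (forall l, 0 <= l -> distr g l = distr f l) ->
  X g /\ ri_norm X g = ri_norm X f.
Proof.
move=> Xf mg gf; apply: ri_rearrangement_invariant => // t t0.
rewrite /decreasing_rearrangement; congr ereal_inf; congr image.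
by apply/seteqP; split=> l /= [l0 H]; split=> //; move: H;
  have := gf l l0; rewrite /distr /level => ->.
Qed.

(** * Disjoint equimeasurable copies of a function *)

(* The block [m, m + 1) holds the piece f|[j, j + 1) of the k-th copy when m is
   the code of the pair (k, j). *)
Definition copy {R : realType} (k : nat) (f : R -> R) (t : R) : R :=
  if pickle_inv (Num.truncn t) is Some (k', j) then
    if k' == k then f (t - (Num.truncn t)%:R + j%:R) else 0
  else 0.

Lemma copy_disjoint {R : realType} (k k' : nat) (f g : R -> R) (t : R) :
  k <> k' -> copy k f t = 0 \/ copy k' g t = 0.
Proof.
rewrite /copy; case: pickle_inv => [[i j]|]; last by left.
case: (eqVneq i k) => [->|]; last by left.
by case: eqP => //; right.
Qed.

Lemma measurable_copy {R : realType} (k : nat) (f : R -> R) :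
  measurable_fun halfline f -> measurable_fun halfline (copy k f).
Proof.
move=> mf.
(* Measurability is checked block by block: on each block the copy is either zero or a translate of
   [f]. *)
have -> : @halfline R = \bigcup_i `[i%:R, i.+1%:R[%classic.
  apply/seteqP; split=> t; rewrite halflineE.
    by move=> t0; exists (Num.truncn t) => //=; rewrite in_itv/= truncn_itv.
  by move=> [i _] /=; rewrite !in_itv/= => /andP[+ _]; apply: le_trans.
apply/measurable_fun_bigcup => [i|i]; first exact: measurable_itv.
case E: (pickle_inv i : option (nat * nat)) => [[k' j]|]; last first.
  apply: (eq_measurable_fun (cst (0 : R))) => // t; rewrite inE/= in_itv/=.
  by move=> /truncn_def ti; rewrite /copy ti E.
have [kk|kk] := eqVneq k' k; last first.
  apply: (eq_measurable_fun (cst (0 : R))) => // t; rewrite inE/= in_itv/=.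
  by move=> /truncn_def ti; rewrite /copy ti E (negbTE kk).
apply: (eq_measurable_fun (f \o (fun t => 1 * t + (j%:R - i%:R)))) => [t|].
  rewrite inE/= in_itv/= => /truncn_def ti; rewrite /copy ti E kk eqxx.
  by congr f; lra.
apply: (measurable_comp measurable_halfline _ mf).
  move=> _ [t /= + <-]; rewrite halflineE in_itv/= => /andP[it _].
  by have := ler0n R j; lra.
exact: measurable_funS (measurable_affine 1 _).
Qed.

(** The level set of [f] is cut at the integers, and the copy only translates the pieces to pairwise
    disjoint blocks. As [l >= 0], the points where the copy is set to zero contribute nothing. *)
Lemma distr_copy {R : realType} (k : nat) (f : R -> R) (l : R) :
  measurable_fun halfline f -> 0 <= l -> distr (copy k f) l = distr f l.
Proof.
move=> mf l0.
pose B j := level f l `&` `[j%:R, j.+1%:R[%classic.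
(* This translation takes the block numbered by the code of [(k, j)] back onto [[j, j + 1)]. *)
pose sh j (t : R) : R := 1 * t + (j%:R - (pickle (k, j))%:R).
have mB j : measurable (B j).
  by apply: measurableI; [exact: measurable_level|exact: measurable_itv].
have mS j : measurable (sh j @^-1` B j).
  by rewrite -[X in measurable X]setTI; apply: measurable_affine.
have levelE : level f l = \bigcup_j B j.
  rewrite -setI_bigcupr; apply/esym/setIidPl => t [/= + _].
  rewrite halflineE => t0; exists (Num.truncn t) => //=.
  by rewrite in_itv/= truncn_itv.
have shE j (t : R) : j%:R <= sh j t < j.+1%:R ->
    Num.truncn t = pickle (k, j) /\ 0 <= t.
  rewrite /sh => /andP[h1 h2]; split.
    apply: truncn_def; rewrite -natr1; rewrite -natr1 in h2.
    by apply/andP; split; lra.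
  by have := ler0n R (pickle (k, j)); lra.
have levelcE : level (copy k f) l = \bigcup_j (sh j @^-1` B j).
  apply/seteqP; split=> t /=.
    move=> []; rewrite halflineE => t0 /=.
    rewrite /copy; case E: pickle_inv => [[k' j]|]; last first.
      by rewrite normr0 ltNge l0.
    case: eqP => [kk|_]; last by rewrite normr0 ltNge l0.
    have tE : Num.truncn t = pickle (k, j).
      have := pickle_invK (T:=(nat*nat)%type) (Num.truncn t).
      by rewrite E /= kk.
    have := truncn_itv t0; rewrite tE -natr1 => /andP[h1 h2] lf.
    have e : sh j t = t - (pickle (k, j))%:R + j%:R by rewrite /sh; lra.
    exists j => //; rewrite /= /B /level /= e.
    split; first split => //.
      by rewrite halflineE; have := ler0n R j; lra.
    by rewrite /= in_itv/= -natr1; apply/andP; split; lra.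
  move=> [j _] [[_ /=] lf /=]; rewrite in_itv/= => /shE [tE t0]; split.
    by rewrite halflineE.
  rewrite /= /copy tE pickleK_inv eqxx; move: lf; congr (_ < `|f _|).
  by rewrite /sh; lra.
rewrite /distr levelE levelcE !measure_bigcup//.
- apply: eq_eseriesr => j _.
  have := lebesgue_measure_affine 1 (j%:R - (pickle (k, j))%:R) _ ltr01 (mB j).
  by rewrite invr1 mul1e.
- by move=> i _; exact: mB.
- move=> i j _ _ [t [[_ /=]]]; rewrite in_itv/= => ti [_ /=].
  by rewrite in_itv/= => /truncn_def <-; exact/esym/truncn_def.
- by move=> i _; exact: mS.
(* The translated pieces are disjoint because [pickle] is injective. *)
- move=> i j _ _ [t [[_ /=]]]; rewrite in_itv/= => /shE[ti _] [_ /=].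
  by rewrite in_itv/= => /shE[+ _]; rewrite ti => /(pcan_inj pickleK)[].
Qed.

Lemma distrD {R : realType} (f g : R -> R) (l : R) :
  measurable_fun halfline f -> measurable_fun halfline g ->
  (forall t, f t = 0 \/ g t = 0) -> 0 <= l ->
  distr (f + g) l = (distr f l + distr g l)%E.
Proof.
move=> mf mg fg l0; rewrite /distr.
have -> : level (f + g) l = level f l `|` level g l.
  apply/seteqP; split=> t.
    move=> [/= t0]; have -> : (f + g) t = f t + g t by [].
    by case: (fg t) => ->; rewrite (add0r, addr0) => H; [right|left].
  move=> [|] [t0 /= lt_l]; split=> //=; have -> : (f + g) t = f t + g t by [].
    case: (fg t) => E; last by rewrite E addr0.
    by move: lt_l; rewrite E normr0 ltNge l0.
  case: (fg t) => E; first by rewrite E add0r.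
  by move: lt_l; rewrite E normr0 ltNge l0.
rewrite measureU//; try exact: measurable_level.
apply/seteqP; split=> // t [[/= _ h1] [/= _ h2]].
by case: (fg t) => E; [move: h1|move: h2]; rewrite E normr0 ltNge l0.
Qed.

Lemma measurable_sum_copy {R : realType} (phi : nat -> nat)
    (F : nat -> R -> R) (n : nat) :
  (forall k, measurable_fun halfline (F k)) ->
  measurable_fun halfline (\sum_(k < n) copy (phi k) (F k)).
Proof.
move=> mF; elim: n => [|n ih]; first by rewrite big_ord0; exact: measurable_cst.
by rewrite big_ord_recr; apply: measurable_funD => //; exact: measurable_copy.
Qed.

(** The indices pass through an injective [phi] because the estimates are only available along a
    subsequence of the copies. *)
Lemma distr_sum_copy {R : realType} (phi : nat -> nat) (F : nat -> R -> R)
    (n : nat) (l : R) :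
  injective phi -> (forall k, measurable_fun halfline (F k)) -> 0 <= l ->
  distr (\sum_(k < n) copy (phi k) (F k)) l = (\sum_(k < n) distr (F k) l)%E.
Proof.
move=> iphi mF l0; elim: n => [|n ih].
  rewrite !big_ord0 /distr (_ : level _ _ = set0) ?measure0//.
  by apply/seteqP; split=> // t [_ /=]; rewrite normr0 ltNge l0.
rewrite !big_ord_recr -ih/= -(distr_copy (phi n) _ _ (mF n) l0).
rewrite distrD//; [exact: measurable_sum_copy|exact: measurable_copy|].
move=> t; case: (eqVneq (copy (phi n) (F n) t) 0) => [|nz]; first by right.
left; rewrite fct_sumE big1// => i _.
have [||/eqP] // := copy_disjoint (phi i) (phi n) (F i) (F n) t.
  by move=> /iphi E; have := ltn_ord i; rewrite E ltnn.
by rewrite (negbTE nz).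
Qed.

(** * Dilations and their distribution functions *)

Lemma measurable_dilation {R : realType} (s : R) (f : R -> R) : 0 < s ->
  measurable_fun halfline f -> measurable_fun halfline (dilation s f).
Proof.
move=> s0 mf.
have -> : dilation s f = f \o (fun t => s^-1 * t + 0).
  by apply/funext => t; rewrite /dilation/= addr0 mulrC.
apply: (measurable_comp measurable_halfline _ mf).
  move=> _ [t + <-]; rewrite /= !halflineE addr0 => t0.
  by rewrite mulr_ge0// invr_ge0 ltW.
exact: measurable_funS (measurable_affine _ _).
Qed.

Lemma distr_dilation {R : realType} (s : R) (f : R -> R) (l : R) : 0 < s ->
  measurable_fun halfline f -> distr (dilation s f) l = (s%:E * distr f l)%E.
Proof.
move=> s0 mf; rewrite /distr.
have -> : level (dilation s f) l = (fun t => s^-1 * t + 0) @^-1` level f l.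
  rewrite /level preimage_setI; congr (_ `&` _); apply/seteqP; split=> t /=;
  by rewrite ?halflineE /dilation addr0 ?(pmulr_rge0 t) ?invr_gt0// mulrC.
by rewrite lebesgue_measure_affine ?invr_gt0 ?invrK//; exact: measurable_level.
Qed.

(** * Copies and dilations inside a rearrangement invariant space *)

Lemma ri_mem0 {R : realType} (X : ri_space R) : X 0.
Proof.
apply: ri_L1_cap_Linfty; first exact: integrable0.
split; first exact: measurable_cst.
by exists 0; apply: aeW => t _; rewrite normr0.
Qed.

Lemma ri_norm0 {R : realType} (X : ri_space R) : ri_norm X 0 = 0.
Proof.
have := @ri_norm_scale _ X 0 0 (ri_mem0 X).
by rewrite scaler0 normr0 mul0r.
Qed.

(** Nonnegativity is not an axiom of [ri_space]; it comes from [0 = |f - f| <= 2 |f|]. *)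
Lemma ri_norm_ge0 {R : realType} {X : ri_space R} (f : R -> R) :
  X f -> 0 <= ri_norm X f.
Proof.
move=> Xf; have XN : X (- f) by rewrite -scaleN1r; exact: ri_scale.
have := ri_norm_triangle Xf XN.
by rewrite subrr ri_norm0 -scaleN1r ri_norm_scale// normrN1 mul1r; lra.
Qed.

Lemma ri_copy {R : realType} {X : ri_space R} (k : nat) (f : R -> R) :
  X f -> X (copy k f) /\ ri_norm X (copy k f) = ri_norm X f.
Proof.
move=> Xf; have mf := ri_measurable Xf.
apply: ri_equimeasurable => //; first exact: measurable_copy.
by move=> l l0; rewrite distr_copy.
Qed.

Lemma ri_sum_copy {R : realType} {X : ri_space R} (phi : nat -> nat)
    (f : R -> R) (n : nat) : X f ->
  X (\sum_(k < n) copy (phi k) f) /\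
  ri_norm X (\sum_(k < n) copy (phi k) f) <= n%:R * ri_norm X f.
Proof.
move=> Xf; elim: n => [|n [Xs le_s]].
  by rewrite big_ord0 ri_norm0 mul0r; split; first exact: ri_mem0.
have [Xc nc] := ri_copy (phi n) f Xf.
rewrite big_ord_recr; split; first exact: ri_add.
apply: (le_trans (ri_norm_triangle Xs Xc)).
by rewrite /= nc -natr1 mulrDl mul1r lerD2r.
Qed.

(** Both functions have [n] times the distribution function of [f]. *)
Lemma ri_dilation_nat {R : realType} {X : ri_space R} (phi : nat -> nat)
    (f : R -> R) (n : nat) : X f -> injective phi -> (0 < n)%N ->
  X (dilation n%:R f) /\
  ri_norm X (dilation n%:R f) = ri_norm X (\sum_(k < n) copy (phi k) f).
Proof.
move=> Xf iphi n0; have mf := ri_measurable Xf.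
have [Xs _] := ri_sum_copy phi f n Xf.
apply: ri_equimeasurable => //; first by
  apply: measurable_dilation; rewrite ?ltr0n.
move=> l l0; rewrite distr_dilation ?ltr0n//.
rewrite (distr_sum_copy phi (fun=> f))// sumr_const card_ord.
by rewrite mule_natl.
Qed.

(* [dilation t f] is equimeasurable with the sum of disjoint copies of
   [dilation s f] and [dilation (t - s) f]. *)
Lemma ri_dilation_le {R : realType} {X : ri_space R} (s t : R) (f : R -> R) :
  0 < s -> s <= t -> measurable_fun halfline f -> X (dilation t f) ->
  X (dilation s f) /\ ri_norm X (dilation s f) <= ri_norm X (dilation t f).
Proof.
move=> s0; rewrite le_eqVlt => /predU1P[<-//|st] mf Xt.
have r0 : 0 < t - s by rewrite subr_gt0.
have ms := measurable_dilation s f s0 mf.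
have mr := measurable_dilation (t - s) f r0 mf.
have mcs := measurable_copy 0 _ ms.
have mcr := measurable_copy 1 _ mr.
pose g := copy 0 (dilation s f) + copy 1 (dilation (t - s) f).
have disj u : copy 0 (dilation s f) u = 0 \/ copy 1 (dilation (t - s) f) u = 0.
  exact: copy_disjoint.
have [|l l0|Xg <-] := ri_equimeasurable (X := X) (dilation t f) g Xt.
- exact: measurable_funD.
- rewrite distrD// !distr_copy// !distr_dilation//; last exact: lt_trans st.
  by rewrite -ge0_muleDl ?lee_fin ?ltW// -EFinD subrKC.
(* Since the two summands of [g] are disjoint, the first is dominated by [g] pointwise, and the
   ideal property gives membership and norm bound at once. *)
have [Xc le_cg] : X (copy 0 (dilation s f)) /\
    ri_norm X (copy 0 (dilation s f)) <= ri_norm X g.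
  apply: ri_ideal => //; apply: aeW => u _; rewrite /g.
  have -> : (copy 0 (dilation s f) + copy 1 (dilation (t - s) f)) u =
    copy 0 (dilation s f) u + copy 1 (dilation (t - s) f) u by [].
  by case: (disj u) => ->; rewrite ?addr0 ?normr0.
have [|l l0|Xs ->] := ri_equimeasurable (X := X) _ (dilation s f) Xc => //.
by rewrite distr_copy.
Qed.

(** Comparison with the next integer dilation. The bound is crude, but it makes the supremum in
    [dilation_norm] finite. *)
Lemma ri_dilation {R : realType} {X : ri_space R} (s : R) (f : R -> R) :
  0 < s -> X f -> X (dilation s f) /\
  ri_norm X (dilation s f) <= (Num.truncn s).+1%:R * ri_norm X f.
Proof.
move=> s0 Xf.
have [Xn nn] := ri_dilation_nat id f (Num.truncn s).+1 Xf (@inj_id nat) isT.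
have [Xs le_s] :=
  ri_dilation_le s _ f s0 (ltW (truncnS_gt s)) (ri_measurable Xf) Xn.
split=> //; apply: (le_trans le_s); rewrite nn.
by case: (ri_sum_copy id f (Num.truncn s).+1 Xf).
Qed.

(** * Operator norms of the dilations *)

Lemma dilation_norm_ub {R : realType} {X : ri_space R} (s : R) (f : R -> R) :
  0 < s -> X f -> ri_norm X (dilation s f) <= dilation_norm X s * ri_norm X f.
Proof.
move=> s0 Xf.
have [f0|f0] := eqVneq (ri_norm X f) 0.
  by have [_] := ri_dilation s f s0 Xf; rewrite f0 !mulr0.
have fp : 0 < ri_norm X f by rewrite lt_def f0 ri_norm_ge0.
have Xg : X ((ri_norm X f)^-1 *: f) by exact: ri_scale.
rewrite -ler_pdivrMr//; apply: ub_le_sup.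
  (* A real [sup] is known to dominate its set only if the set is bounded above; the crude bound
     supplies this. *)
  exists (Num.truncn s).+1%:R => _ [h [Xh h1] <-].
  have [_ /le_trans] := ri_dilation s h s0 Xh; apply.
  by rewrite ler_piMr.
exists ((ri_norm X f)^-1 *: f).
  by split=> //; rewrite ri_norm_scale// gtr0_norm ?invr_gt0// mulVf.
have -> : dilation s ((ri_norm X f)^-1 *: f) = (ri_norm X f)^-1 *: dilation s f.
  by [].
rewrite ri_norm_scale; last by case: (ri_dilation s f s0 Xf).
by rewrite gtr0_norm ?invr_gt0// mulrC.
Qed.

Lemma dilation_norm_lub {R : realType} {X : ri_space R} (s K : R) :
  0 < s -> 0 <= K ->
  (forall f, X f -> ri_norm X (dilation s f) <= K * ri_norm X f) ->
  dilation_norm X s <= K.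
Proof.
move=> s0 K0 le_K; apply: ge_sup.
  exists (ri_norm X (dilation s 0)), 0 => //.
  by split; [exact: ri_mem0|rewrite ri_norm0].
move=> _ [f [Xf f1] <-]; apply: (le_trans (le_K f Xf)).
by rewrite ler_piMr.
Qed.

(** The witness is the indicator of [[0, 1]]. If its norm were zero, [[0, 1]] would lie in a null
    set. *)
Lemma ri_nontrivial {R : realType} (X : ri_space R) :
  exists2 f, X f & 0 < ri_norm X f.
Proof.
pose f : R -> R := \1_`[0, 1]%classic.
have Xf : X f.
  apply: ri_L1_cap_Linfty.
    apply: integrableS (integrable_indic_itv 0 1 true false) => //.
    exact: measurable_halfline.
  split; first exact: measurable_indic.
  by exists 1; apply: aeW => t _; rewrite /f indicE; case: (t \in _);
    rewrite ?normr1 ?normr0.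
exists f => //; rewrite lt_def ri_norm_ge0// andbT; apply/eqP => f0.
have [N [mN N0 sub]] := ri_norm_definite Xf f0.
suff : (1%:E <= lebesgue_measure N)%E by rewrite N0 lee_fin ler10.
have -> : 1%:E = lebesgue_measure (`[0, 1]%classic : set R).
  by rewrite lebesgue_measure_itv/= lte01 -EFinB subr0.
apply: le_measure; rewrite ?inE// => t t01; apply: sub => /=.
move=> /(_ _); rewrite halflineE /f indicE mem_set// => H.
have : 0 <= t by move: t01; rewrite /= in_itv/= => /andP[].
by move=> /H /eqP; rewrite oner_eq0.
Qed.

Lemma dilation_norm_ge0 {R : realType} (X : ri_space R) (s : R) :
  0 < s -> 0 <= dilation_norm X s.
Proof.
move=> s0; have [f Xf f0] := ri_nontrivial X.
rewrite -(pmulr_lge0 _ f0); apply: le_trans (dilation_norm_ub s f s0 Xf).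
by apply: ri_norm_ge0; case: (ri_dilation s f s0 Xf).
Qed.

Lemma dilation_norm1 {R : realType} (X : ri_space R) : dilation_norm X 1 = 1.
Proof.
have dil1 f : dilation (1 : R) f = f.
  by apply/funext => t; rewrite /dilation divr1.
apply/eqP; rewrite eq_le; apply/andP; split.
  by apply: dilation_norm_lub => // f Xf; rewrite dil1 mul1r.
have [f Xf f0] := ri_nontrivial X.
have := dilation_norm_ub (X := X) 1 f ltr01 Xf.
by rewrite dil1 -ler_pdivrMr// mulfV// lt0r_neq0.
Qed.

Lemma dilation_normM {R : realType} (X : ri_space R) (s t : R) :
  0 < s -> 0 < t ->
  dilation_norm X (s * t) <= dilation_norm X s * dilation_norm X t.
Proof.
move=> s0 t0; apply: dilation_norm_lub; first exact: mulr_gt0.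
  by rewrite mulr_ge0 ?dilation_norm_ge0.
move=> f Xf.
have -> : dilation (s * t) f = dilation s (dilation t f).
  by apply/funext => u; rewrite /dilation invfM mulrA.
have [Xt _] := ri_dilation t f t0 Xf.
apply: (le_trans (dilation_norm_ub s _ s0 Xt)); rewrite -mulrA.
by rewrite ler_wpM2l ?dilation_norm_ge0 ?dilation_norm_ub.
Qed.

(** Submultiplicativity gives [1 = |D_1| <= |D_s| |D_(1/s)|]. Positivity is what makes the logarithm
    of the norm meaningful. *)
Lemma dilation_norm_gt0 {R : realType} (X : ri_space R) (s : R) :
  0 < s -> 0 < dilation_norm X s.
Proof.
move=> s0; rewrite lt_def dilation_norm_ge0// andbT; apply/eqP => ds.
have := dilation_normM X s s^-1 s0; rewrite invr_gt0 => /(_ s0).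
by rewrite mulfV ?lt0r_neq0// dilation_norm1 ds mul0r ler10.
Qed.

Lemma le_dilation_norm {R : realType} (X : ri_space R) (s t : R) :
  0 < s -> s <= t -> dilation_norm X s <= dilation_norm X t.
Proof.
move=> s0 st; have t0 := lt_le_trans s0 st.
apply: dilation_norm_lub => //; first exact: dilation_norm_ge0.
move=> f Xf; have [Xt _] := ri_dilation t f t0 Xf.
apply: le_trans (dilation_norm_ub t f t0 Xf).
by case: (ri_dilation_le s t f s0 st (ri_measurable Xf) Xt).
Qed.

(** * From estimates on disjoint sequences to bounds on dilation norms *)

Lemma normalized_disjoint_copy {R : realType} {X : ri_space R} (f : R -> R) :
  X f -> ri_norm X f = 1 -> normalized_disjoint X (fun k => copy k f).
Proof.
move=> Xf f1; split=> [n|n|m n mn]; first by case: (ri_copy n f Xf).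
  by case: (ri_copy n f Xf) => _ ->.
apply: aeW => t _; case: (copy_disjoint m n f f t mn) => ->;
rewrite normr0; first by rewrite min_l.
by rewrite min_r.
Qed.

Lemma ri_dilation_nat_copies {R : realType} {X : ri_space R} (f : R -> R)
    (phi : nat -> nat) (n : nat) : X f -> {homo phi : i j / (i < j)%N} ->
  (0 < n)%N ->
  ri_norm X (dilation n%:R f) =
  ri_norm X (\sum_(k < n) (1 : R) *: ((fun k => copy k f) \o phi) k).
Proof.
move=> Xf mphi n0.
have iphi : injective phi.
  move=> i j eq_ij; apply/eqP; rewrite eqn_leq; apply/andP; split;
  by rewrite leqNgt; apply/negP => /mphi; rewrite eq_ij ltnn.
have [_ ->] := ri_dilation_nat phi f n Xf iphi n0.
by congr ri_norm; apply: eq_bigr => k _; rewrite scale1r.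
Qed.

Lemma sum_powR1 {R : realType} (p : R) (n : nat) :
  (\sum_(k < n) `|(1 : R)| `^ p) = n%:R.
Proof.
under eq_bigr do rewrite normr1 powR1.
by rewrite sumr_const card_ord.
Qed.

Lemma ri_normalize {R : realType} {X : ri_space R} (f : R -> R) :
  X f -> ri_norm X f != 0 ->
  exists2 g, X g & ri_norm X g = 1 /\ f = ri_norm X f *: g.
Proof.
move=> Xf f0; exists ((ri_norm X f)^-1 *: f); first exact: ri_scale.
rewrite ri_norm_scale// ger0_norm ?invr_ge0 ?ri_norm_ge0// mulVf//.
by split=> //; rewrite scalerA mulfV// scale1r.
Qed.

(** The upper estimate is applied to copies of a normalized function with all coefficients 1. The
    subsequence depends on the function but [C] does not, so the bound passes to the operator
    norm. *)
Lemma UDS_dilation_norm {R : realType} (X : ri_space R) (p : R) :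
  UDS p X -> exists2 C, 0 < C &
    forall n, (0 < n)%N -> dilation_norm X n%:R <= C * n%:R `^ p^-1.
Proof.
move=> [C C0 HC]; exists C => // n n0.
have n0' : 0 < n%:R :> R by rewrite ltr0n.
apply: dilation_norm_lub => // [|f Xf].
  by rewrite mulr_ge0 ?powR_ge0 ?ltW.
have [f0|f0] := eqVneq (ri_norm X f) 0.
  by have := dilation_norm_ub _ f n0' Xf; rewrite f0 !mulr0.
have [g Xg [g1 ->]] := ri_normalize f Xf f0.
have [Xd _] := ri_dilation _ g n0' Xg.
have -> : dilation n%:R (ri_norm X f *: g) = ri_norm X f *: dilation n%:R g
  by [].
rewrite !ri_norm_scale// g1 mulr1 mulrC ler_wpM2r//.
have [phi mphi up] := HC _ (normalized_disjoint_copy g Xg g1).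
rewrite (ri_dilation_nat_copies g phi)//.
by have := up n (fun=> 1); rewrite sum_powR1.
Qed.

(** The lower estimate is applied to copies of the normalization of [h = D_(1/n) f], whose dilation
    by [n] is a multiple of [f]. *)
Lemma UDT_dilation_norm {R : realType} (X : ri_space R) (q : R) :
  UDT q X -> exists2 C, 0 < C &
    forall n, (0 < n)%N -> dilation_norm X n%:R^-1 <= (C * n%:R `^ q^-1)^-1.
Proof.
move=> [C C0 HC]; exists C => // n n0.
have n0' : 0 < n%:R :> R by rewrite ltr0n.
have Cn0 : 0 < C * n%:R `^ q^-1 by rewrite mulr_gt0 ?powR_gt0.
have nV0 : 0 < n%:R^-1 :> R by rewrite invr_gt0.
apply: dilation_norm_lub => // [|f Xf]; first by rewrite invr_ge0 ltW.
have [Xh _] := ri_dilation _ f nV0 Xf.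
set h := dilation n%:R^-1 f in Xh *.
have fE : f = dilation n%:R h.
  apply/funext => t; rewrite /h /dilation invrK -mulrA mulVf ?mulr1//.
  exact: lt0r_neq0.
rewrite [in leRHS]fE ler_pdivlMl//.
have [h0|h0] := eqVneq (ri_norm X h) 0.
  by rewrite h0 mulr0 -fE ri_norm_ge0.
have [g Xg [g1 hE]] := ri_normalize h Xh h0.
have [Xd _] := ri_dilation _ g n0' Xg.
have -> : dilation n%:R h = ri_norm X h *: dilation n%:R g
  by rewrite [in LHS]hE.
rewrite !ri_norm_scale// ger0_norm ?ri_norm_ge0// mulrC.
rewrite ler_wpM2l ?ri_norm_ge0//.
have [phi mphi lo] := HC _ (normalized_disjoint_copy g Xg g1).
rewrite (ri_dilation_nat_copies g phi)//.
by have := lo n (fun=> 1); rewrite sum_powR1.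
Qed.

(** * Fekete's lemma and limits of inverse ratios *)

(** The limit is the infimum of [phi u / u]. The first hypothesis is what subadditivity and
    monotonicity yield after division of [u] by [v] with remainder; in this form it serves
    nondecreasing and nonincreasing functions alike. *)
Lemma fekete_limit {R : realType} (phi : R -> R) (B : R) :
  (forall v, 0 < v -> exists a, forall u, 0 < u ->
    phi u <= a + phi v / v * u) ->
  (forall u, 0 < u -> B <= phi u / u) ->
  exists2 L, phi u / u @[u --> +oo] --> L &
    forall a b, (forall u, 0 < u -> phi u <= a + b * u) -> L <= b.
Proof.
move=> sub lb.
pose S := [set phi u / u | u in [set u | 0 < u]].
have Slb : has_lbound S by exists B => _ [u u0 <-]; exact: lb.
have Sinf : has_inf S by split=> //; exists (phi 1 / 1), 1 => //=.
have Lle u : 0 < u -> inf S <= phi u / u.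
  by move=> u0; apply: ge_inf => //; exists u.
exists (inf S).
  apply/cvgrPdist_le => e e0.
  have e20 : 0 < e / 2 by rewrite divr_gt0.
  have [_ [v /= v0 <-] lt_v] := inf_adherent e20 Sinf.
  have [a le_a] := sub v v0.
  near=> u.
  have u0 : 0 < u by near: u; apply: nbhs_pinfty_gt; exact: num_real.
  have uae : 2 * `|a| / e <= u
    by near: u; apply: nbhs_pinfty_ge; exact: num_real.
  rewrite distrC ger0_norm ?subr_ge0 ?Lle//.
  have au : a / u <= e / 2.
    move: uae; rewrite !ler_pdivrMr// => uae; have := ler_norm a. lra.
  have : phi u / u <= a / u + phi v / v.
    by rewrite ler_pdivrMr// mulrDl divfK ?lt0r_neq0// le_a.
  by lra.
move=> a b ab; rewrite leNgt; apply/negP => bL.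
have bL0 : 0 < inf S - b by rewrite subr_gt0.
(* At this point [inf S * u <= phi u <= a + b * u] would give [(inf S - b) * u <= a], whereas the
   left side equals [|a| + 1]. *)
pose u := (`|a| + 1) / (inf S - b).
have u0 : 0 < u by rewrite divr_gt0// ltr_wpDl.
have := Lle u u0; rewrite ler_pdivlMr// => h.
have := le_trans h (ab u u0); rewrite -lerBlDr -mulrBl mulrC.
rewrite /u divfK ?lt0r_neq0//.
by have := ler_norm a; lra.
Unshelve. all: by end_near. Qed.

(** A nonzero limit forces [phi u != 0] eventually, so the branch with value [+oo] is left for
    good. *)
Lemma cvg_inv_ratio {R : realType} (phi : R -> R) (L : R) : L != 0 ->
  phi u / u @[u --> +oo] --> L ->
  (if phi u == 0 then +oo%E else (u / phi u)%:E) @[u --> +oo] --> L^-1%:E.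
Proof.
move=> L0 phiL.
have : (EFin \o (fun u => (phi u / u)^-1)) u @[u --> +oo] --> L^-1%:E.
  by apply: cvg_EFin; [exact: nearW|exact: cvgV].
apply: cvg_trans; apply: near_eq_cvg; near=> u => /=.
have : phi u / u != 0.
  by near: u; apply: cvgr_neq0 phiL L0.
by rewrite mulf_eq0 negb_or => /andP[/negbTE -> _]; rewrite invf_div.
Unshelve. all: by end_near. Qed.

(** Where [phi u = 0] the convention already gives [+oo]; elsewhere [phi u] is positive and small
    compared with [u]. *)
Lemma cvg_inv_ratio_pinfty {R : realType} (phi : R -> R) :
  (forall u, 0 < u -> 0 <= phi u) -> phi u / u @[u --> +oo] --> (0 : R) ->
  (if phi u == 0 then +oo%E else (u / phi u)%:E) @[u --> +oo] --> +oo%E.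
Proof.
move=> phi0 phiL; apply/cvgeyPge => A; near=> u.
have u0 : 0 < u by near: u; apply: nbhs_pinfty_gt; exact: num_real.
case: eqP => [_|/eqP phin0]; first by rewrite leey.
have phip : 0 < phi u by rewrite lt_def phin0 phi0.
(* The bound [A] may be negative, so it is replaced by a larger positive number that can be
   inverted. *)
have A0 : 0 < `|A| + 1 by rewrite ltr_wpDl.
rewrite lee_fin ler_pdivlMr//; apply: (@le_trans _ _ ((`|A| + 1) * phi u)).
  by rewrite ler_wpM2r ?ltW//; have := ler_norm A; lra.
rewrite -ler_pdivlMl// -ler_pdivrMr//.
near: u; apply: cvgr_le phiL _ _; by rewrite invr_gt0.
Unshelve. all: by end_near. Qed.

Lemma cvg_ln_pinfty {R : realType} : @ln R x @[x --> +oo] --> +oo.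
Proof.
apply/cvgryPge => A; near=> x.
have : expR A <= x by near: x; apply: nbhs_pinfty_ge; exact: num_real.
move=> Ax; have x0 : 0 < x by exact: lt_le_trans (expR_gt0 A) Ax.
by rewrite -ler_expR lnK.
Unshelve. all: by end_near. Qed.

(** * Boyd indices through the logarithm of the dilation norm *)

Section log_dilation_norm.
Context {R : realType} (X : ri_space R).
Implicit Types u v : R.

Let h u := ln (dilation_norm X (expR u)).

Let h0 : h 0 = 0. Proof. by rewrite /h expR0 dilation_norm1 ln1. Qed.

Let pos u : 0 < dilation_norm X (expR u).
Proof. exact: dilation_norm_gt0 (expR_gt0 u). Qed.

Lemma log_dilation_normD u v : h (u + v) <= h u + h v.
Proof.
rewrite /h -lnM ?posrE ?pos// ler_ln ?posrE ?pos ?mulr_gt0 ?pos// expRD.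
exact: dilation_normM (expR_gt0 u) (expR_gt0 v).
Qed.

Lemma le_log_dilation_norm u v : u <= v -> h u <= h v.
Proof.
move=> uv; rewrite ler_ln ?posrE ?pos//.
by apply: le_dilation_norm; rewrite ?expR_gt0 ?ler_expR.
Qed.

Lemma log_dilation_norm_nat (n : nat) v : h (n%:R * v) <= n%:R * h v.
Proof.
elim: n => [|n ih]; first by rewrite !mul0r h0.
rewrite -natr1 !mulrDl !mul1r.
by apply: (le_trans (log_dilation_normD _ _)); rewrite lerD2r.
Qed.

(** Positivity of the norm matters: only then does a zero logarithm mean that the norm is 1. *)
Lemma boyd_ratioE (s : R) : 0 < s ->
  boyd_ratio X s = if h (ln s) == 0 then +oo%E else (ln s / h (ln s))%:E.
Proof.
move=> s0; rewrite /boyd_ratio /h lnK ?posrE//.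
by rewrite ln_eq0 ?dilation_norm_gt0.
Qed.

(** The Fekete limit [L] of [h u / u] is the reciprocal of the index, and the linear bound on [h]
    gives [L <= p^-1]. The case [L = 0] corresponds to the index [+oo]. *)
Lemma lower_boyd_index_ge (p a : R) : 0 < p ->
  (forall u, 0 < u -> h u <= a + p^-1 * u) ->
  (p%:E <= lower_boyd_index X)%E.
Proof.
move=> p0 le_h.
have hpos u : 0 < u -> 0 <= h u.
  by move=> u0; rewrite -h0; exact: le_log_dilation_norm (ltW u0).
have [v v0|u u0|L Llim Lle] := @fekete_limit R h 0.
(* With [n] the integer part of [u / v], rounding up gives
   [h u <= (n + 1) h v <= h v + (u / v) h v], since [h v >= 0]. *)
- exists (h v) => u u0.
  have uv0 : 0 <= u / v by rewrite divr_ge0 ?ltW.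
  have /andP[le_n lt_n] := truncn_itv uv0.
  apply: (@le_trans _ _ (h ((Num.truncn (u / v)).+1%:R * v))).
    by apply: le_log_dilation_norm; rewrite -ler_pdivrMr// ltW.
  apply: (le_trans (log_dilation_norm_nat _ _)).
  rewrite mulrAC -mulrA -natr1 mulrDl mul1r addrC lerD2l (mulrC (h v)).
  by rewrite ler_wpM2r// hpos.
- by rewrite divr_ge0 ?hpos// ltW.
have Lp := Lle _ _ le_h.
have L0 : 0 <= L.
  apply: (cvgr_to_ge Llim); near=> u.
  have u0 : 0 < u by near: u; apply: nbhs_pinfty_gt; exact: num_real.
  by rewrite divr_ge0 ?hpos// ltW.
pose G u : \bar R := if h u == 0 then +oo%E else (u / h u)%:E.
have Gcvg l : G u @[u --> +oo] --> l -> lower_boyd_index X = l.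
  move=> Gl; apply: cvg_lim; first exact: ereal_hausdorff.
  have := cvg_comp _ _ cvg_ln_pinfty Gl.
  apply: cvg_trans; apply: near_eq_cvg; near=> s.
  have s0 : 0 < s by near: s; apply: nbhs_pinfty_gt; exact: num_real.
  by rewrite /= boyd_ratioE.
have [Lz|Lnz] := eqVneq L 0.
  rewrite (Gcvg +oo%E) ?leey//; apply: cvg_inv_ratio_pinfty => //.
  by rewrite -Lz.
rewrite (Gcvg _ (cvg_inv_ratio h L Lnz Llim)) lee_fin.
by rewrite -[leLHS]invrK lef_pV2 ?posrE ?invr_gt0// lt_def Lnz.
Unshelve. all: by end_near. Qed.

(** The substitution [u = - ln s] moves the limit at [0^'+] to [+oo] and replaces [h] by
    [k u = h (- u)], which is subadditive, nonincreasing and nonpositive for [u > 0]. The index is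
    [- L^-1], where [L] is the limit of [k u / u]. *)
Lemma upper_boyd_index_le (q a : R) : 0 < q ->
  (forall u, 0 < u -> h (- u) <= a - q^-1 * u) ->
  (upper_boyd_index X <= q%:E)%E.
Proof.
move=> q0 le_h.
pose k u := h (- u).
have kneg u : 0 < u -> k u <= 0.
  by move=> u0; rewrite -h0; apply: le_log_dilation_norm; lra.
have hpos u : 0 < u -> 0 <= h u.
  by move=> u0; rewrite -h0; exact: le_log_dilation_norm (ltW u0).
have knat n v : k (n%:R * v) <= n%:R * k v.
  by rewrite /k -mulrN; exact: log_dilation_norm_nat.
have hk u : - h u <= k u.
  by have := log_dilation_normD u (- u); rewrite subrr h0 /k; lra.
(* Linear growth of [h], combined with [- h u <= k u], will bound [k u / u] from below. *)
have hlin u : 0 < u -> h u <= (u + 1) * h 1.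
  move=> u0; have /andP[le_n lt_n] := truncn_itv (ltW u0).
  apply: (@le_trans _ _ (h ((Num.truncn u).+1%:R * 1))).
    by apply: le_log_dilation_norm; rewrite mulr1 ltW.
  apply: (le_trans (log_dilation_norm_nat _ _)).
  by rewrite ler_wpM2r ?hpos// -natr1 lerD2r.
have ksub v : 0 < v -> exists a, forall u, 0 < u -> k u <= a + k v / v * u.
  (* Since [k] is nonincreasing, [u / v] is now rounded down to [n]: [k u <= n k v], and
     [(n + 1) k v <= (u / v) k v] because [k v <= 0]. *)
  move=> v0; exists (- k v) => u u0.
  have uv0 : 0 <= u / v by rewrite divr_ge0 ?ltW.
  have /andP[le_n lt_n] := truncn_itv uv0.
  apply: (@le_trans _ _ (k ((Num.truncn (u / v))%:R * v))).
    by apply: le_log_dilation_norm; rewrite lerN2 -ler_pdivlMr.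
  apply: (le_trans (knat _ _)).
  have -> : k v / v * u = (u / v) * k v by rewrite mulrC mulrCA mulrC.
  have : ((Num.truncn (u / v))%:R + 1) * k v <= (u / v) * k v.
    by rewrite ler_wnM2r ?kneg// natr1 ltW.
  by lra.
(* k (n u) <= n k u with n u >= 1 reduces the bound to arguments at least 1. *)
have klb u : 0 < u -> - (2 * h 1) <= k u / u.
  move=> u0; rewrite ler_pdivlMr//.
  pose n := (Num.truncn u^-1).+1.
  have n0 : 0 < n%:R :> R by rewrite ltr0n.
  have nu : 1 <= n%:R * u by rewrite -ler_pdivrMr// mul1r ltW// truncnS_gt.
  rewrite -(ler_pM2l n0); apply: le_trans (knat n u).
  apply: le_trans (hk (n%:R * u)); rewrite lerNr.
  apply: (le_trans (hlin _ (lt_le_trans ltr01 nu))).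
  have := ler_wpM2r (hpos 1 ltr01) nu; lra.
have [L Llim Lub] := fekete_limit k _ ksub klb.
have Lq : L <= - q^-1.
  by apply: (Lub a) => u u0; have := le_h u u0; rewrite mulNr.
(* Strict negativity excludes an infinite index, so no case distinction on [L] arises here. *)
have Lneg : L < 0 by apply: (le_lt_trans Lq); rewrite oppr_lt0 invr_gt0.
have Nlim : - k u / u @[u --> +oo] --> - L.
  by under eq_fun do rewrite mulNr; exact: cvgN.
have NL0 : - L != 0 by rewrite oppr_eq0 lt_eqF.
suff -> : upper_boyd_index X = (- L)^-1%:E.
  by rewrite lee_fin -[leRHS]invrK lef_pV2 ?posrE ?invr_gt0 ?oppr_gt0// lerNr.
apply: cvg_lim; first exact: ereal_hausdorff.
have lnNpinfty : - ln s @[s --> 0^'+] --> (+oo : set_system R).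
  exact: (cvgNry (@ln R)).2 (@lnNy R).
have := cvg_comp _ _ lnNpinfty (cvg_inv_ratio _ _ NL0 Nlim).
apply: cvg_trans; apply: near_eq_cvg; near=> s.
have s0 : 0 < s by near: s; exact: nbhs_right_gt.
by rewrite /= boyd_ratioE// /k opprK oppr_eq0 invrN mulrNN.
Unshelve. all: by end_near. Qed.

End log_dilation_norm.

(** * From integer dilations to all dilations, and the conclusion *)

Lemma UDS_lower_boyd_index {R : realType} (X : ri_space R) (p : R) :
  0 < p -> UDS p X -> (p%:E <= lower_boyd_index X)%E.
Proof.
move=> p0 /UDS_dilation_norm[C C0 le_dn].
(* The term with [ln 2] pays for rounding up [expR u] to an integer [n]: as [expR u >= 1], one has
   [n <= 2 * expR u]. *)
apply: (lower_boyd_index_ge X p (ln C + p^-1 * ln 2)) => // u u0.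
pose n := (Num.truncn (expR u)).+1.
have n0 : 0 < n%:R :> R by rewrite ltr0n.
have nP0 : 0 < n%:R `^ p^-1 by rewrite powR_gt0.
have le_n : n%:R <= 2 * expR u.
  have := expR_ge1Dx u; have /andP[+ _] := truncn_itv (expR_ge0 u).
  by rewrite /n -natr1; lra.
have eu0 := expR_gt0 u.
apply: (@le_trans _ _ (ln (C * n%:R `^ p^-1))).
  rewrite ler_ln ?posrE ?dilation_norm_gt0 ?mulr_gt0//.
  apply: le_trans (le_dn n isT); apply: le_dilation_norm => //.
  by rewrite ltW// truncnS_gt.
rewrite lnM ?posrE// ln_powR -addrA lerD2l -mulrDr.
rewrite ler_wpM2l ?invr_ge0 ?(ltW p0)//.
rewrite -[X in _ <= _ + X]expRK -lnM ?posrE// ler_ln ?posrE//.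
by rewrite mulr_gt0.
Qed.

Lemma UDT_upper_boyd_index {R : realType} (X : ri_space R) (q : R) :
  0 < q -> UDT q X -> (upper_boyd_index X <= q%:E)%E.
Proof.
move=> q0 /UDT_dilation_norm[C C0 le_dn].
(* Here [expR u] is rounded down to [n >= 1], so that [expR (- u) <= n^-1]; the loss is again a
   factor 2, from [expR u <= 2 * n]. *)
apply: (upper_boyd_index_le X q (q^-1 * ln 2 - ln C)) => // u u0.
pose n := Num.truncn (expR u).
have eu0 := expR_gt0 u.
have eu1 : 1 <= expR u by rewrite -expR0 ler_expR ltW.
have n_gt0 : (0 < n)%N by rewrite truncn_gt0.
have n1 : 1 <= n%:R :> R by rewrite ler1n.
have n0 : 0 < n%:R :> R by rewrite ltr0n.
have nP0 : 0 < n%:R `^ q^-1 by rewrite powR_gt0.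
have /andP[le_n lt_n] := truncn_itv (expR_ge0 u).
have le_2n : expR u <= 2 * n%:R by move: lt_n; rewrite -natr1 -/n; lra.
apply: (@le_trans _ _ (ln (C * n%:R `^ q^-1)^-1)).
  rewrite ler_ln ?posrE ?dilation_norm_gt0 ?invr_gt0 ?mulr_gt0 ?expR_gt0//.
  apply: le_trans (le_dn n n_gt0).
  apply: le_dilation_norm; first exact: expR_gt0.
  by rewrite expRN lef_pV2 ?posrE.
rewrite lnV ?posrE ?mulr_gt0// lnM ?posrE// ln_powR.
have : q^-1 * u <= q^-1 * (ln 2 + ln n%:R).
  rewrite ler_wpM2l ?invr_ge0 ?(ltW q0)// -lnM ?posrE//.
  by rewrite -[leLHS]expRK ler_ln ?posrE ?mulr_gt0.
by rewrite mulrDr; lra.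
Qed.

Theorem proposition3 (R : realType) (X : ri_space R) (p q : R) :
  ri_separable X -> 1 < p -> 1 < q ->
  (UDS p X -> (p%:E <= lower_boyd_index X)%E) /\
  (UDT q X -> (upper_boyd_index X <= q%:E)%E).
Proof.
move=> _ p1 q1; split;
  [apply: UDS_lower_boyd_index|apply: UDT_upper_boyd_index].
  exact: lt_trans p1.
exact: lt_trans q1.
Qed.
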